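(* Let $S>0$, $\lambda>0$ and let $\tilde Z_t=\lambda I_{Kd}+\tilde V_t\tilde\Lambda_t\tilde V_t^\top$, where $\tilde V_t\in\mathbb{R}^{Kd\times(m+K)}$ has orthonormal columns $\tilde v_1,\dots,\tilde v_{m+K}$ and $\tilde\Lambda_t\in\mathbb{R}^{(m+K)\times(m+K)}$ is diagonal and positive semidefinite with $i$-th diagonal element $\mu_i$. Let $W'\in\mathbb{R}^{K\times d}$ and let $W_{t+1}$ be the projection $$W_{t+1}=\arg\min_{\|W\|_F\le S}\left\|\overrightarrow{W}-\overrightarrow{W'}\right\|_{\tilde Z_t}^2 .$$ If $\|\overrightarrow{W'}\|_2\le S$, then $\overrightarrow{W}_{t+1}=\overrightarrow{W'}$. Otherwise, $$\overrightarrow{W}_{t+1}=\left(\frac{\lambda}{\lambda+\nu}I+\frac{\nu}{\lambda+\nu}\tilde V_t\tilde\Lambda_tM\tilde V_t^\top\right)\overrightarrow{W'},$$ where $M=((\lambda+\nu)I_{m+K}+\tilde\Lambda_t)^{-1}$ is diagonal, and the dual variable $\nu>0$ is the unique root of $f(\nu)=S^2$, where $f$ is the function, monotonically decreasing on $(0,+\infty)$, $$f(\nu)=\frac{\left(\|\overrightarrow{W'}\|_2^2-\|\tilde V_t^\top\overrightarrow{W'}\|_2^2\right)\lambda^2}{(\lambda+\nu)^2}+\sum_{i=1}^{m+K}\frac{(\tilde v_i^\top\overrightarrow{W'})^2(\mu_i+\lambda)^2}{(\mu_i+\lambda+\nu)^2}.$$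
   Context: For $W\in\mathbb{R}^{K\times d}$, $\overrightarrow{W}\in\mathbb{R}^{Kd}$ is its row-wise vectorization (so $\|\overrightarrow{W}\|_2=\|W\|_F$). For positive semidefinite $Z$, $\|x\|_Z=\sqrt{x^\top Zx}$. $K,d,m$ are positive integers. In the paper $W'$ is the unconstrained gradient-step iterate $\overrightarrow{W'}=\overrightarrow{W}_t-\eta\tilde Z_t^{-1}\nabla\ell_t(W_t)$ of an online Newton step, $S$ is the radius of the parameter domain $\{\|W\|_F\le S\}$, and $\lambda$ is the regularization parameter. *)

(* Defs.v *)
From HB Require Import structures.
From mathcomp Require Import all_boot all_order all_algebra.
From mathcomp Require Import reals.

Set Implicit Arguments.
Unset Strict Implicit.
Unset Printing Implicit Defensive.
Import Order.TTheory GRing.Theory Num.Theory.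
Local Open Scope ring_scope.

(* [mxvec] lists the entries row by row; vectors are taken as columns. *)
Definition vec (R : realType) (K d : nat) (W : 'M[R]_(K, d)) : 'cV[R]_(K * d) :=
  (mxvec W)^T.

Definition norm2 (R : realType) (n : nat) (x : 'cV[R]_n) : R :=
  Num.sqrt (\sum_i x i 0 ^+ 2).

Definition frobenius_norm (R : realType) (K d : nat) (W : 'M[R]_(K, d)) : R :=
  Num.sqrt (\sum_i \sum_j W i j ^+ 2).

Definition quad_form (R : realType) (n : nat) (Z : 'M[R]_n) (x : 'cV[R]_n) : R :=
  (x^T *m Z *m x) 0 0.

Definition psdmx (R : realType) (n : nat) (Z : 'M[R]_n) : Prop :=
  Z^T = Z /\ forall x : 'cV[R]_n, 0 <= quad_form Z x.

Definition weighted_norm (R : realType) (n : nat) (Z : 'M[R]_n)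
    (x : 'cV[R]_n) : R :=
  Num.sqrt (quad_form Z x).

Definition orthonormal_cols (R : realType) (n p : nat) (V : 'M[R]_(n, p)) : Prop :=
  V^T *m V = 1%:M.

Definition is_argmin_on (R : realType) (T : Type) (P : T -> Prop) (g : T -> R)
    (x : T) : Prop :=
  P x /\ forall y, P y -> g x <= g y.

Definition proj_objective (R : realType) (K d : nat) (Z : 'M[R]_(K * d))
    (W' W : 'M[R]_(K, d)) : R :=
  weighted_norm Z (vec W - vec W') ^+ 2.

Definition is_projection (R : realType) (K d : nat) (S : R) (Z : 'M[R]_(K * d))
    (W' W : 'M[R]_(K, d)) : Prop :=
  is_argmin_on (fun U => frobenius_norm U <= S) (proj_objective Z W') W.

(* The constraint enters as ||U||_F^2 - S^2 <= 0; scaling the objective and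
   this constraint by the same factor, e.g. 1/2, leaves the multiplier
   unchanged. *)
Definition lagrangian (R : realType) (K d : nat) (S : R) (Z : 'M[R]_(K * d))
    (W' : 'M[R]_(K, d)) (nu : R) (U : 'M[R]_(K, d)) : R :=
  proj_objective Z W' U + nu * (frobenius_norm U ^+ 2 - S ^+ 2).

(* KKT multiplier at the primal solution [W]: dual feasibility, minimality of
   the Lagrangian over the whole space, complementary slackness. *)
Definition is_dual_variable (R : realType) (K d : nat) (S : R)
    (Z : 'M[R]_(K * d)) (W' W : 'M[R]_(K, d)) (nu : R) : Prop :=
  [/\ 0 <= nu,
      is_argmin_on (fun=> True) (lagrangian S Z W' nu) W
    & nu * (frobenius_norm W ^+ 2 - S ^+ 2) = 0].

Definition secular (R : realType) (n p : nat) (lambda : R) (V : 'M[R]_(n, p))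
    (Lam : 'M[R]_p) (w : 'cV[R]_n) (nu : R) : R :=
  (norm2 w ^+ 2 - norm2 (V^T *m w) ^+ 2) * lambda ^+ 2 / (lambda + nu) ^+ 2
  + \sum_(i < p) (((col i V)^T *m w) 0 0) ^+ 2 * (Lam i i + lambda) ^+ 2
                 / (Lam i i + lambda + nu) ^+ 2.

(* Main.v *)
Require Import Defs.
From HB Require Import structures.
From mathcomp Require Import all_boot all_order all_algebra.
From mathcomp Require Import reals.
From mathcomp Require Import classical_sets topology normedtype.
From mathcomp Require Import ring lra.

Set Implicit Arguments.
Unset Strict Implicit.
Unset Printing Implicit Defensive.
Import Order.TTheory GRing.Theory Num.Theory.
Import numFieldNormedType.Exports.
Local Open Scope ring_scope.

(* Any feasible [X] with [(Z + nu) X = Z W'] and complementary slackness makes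
   the Lagrangian at [U] exceed its value at [X] by the quadratic form of
   [Z + nu] at [U - X]; as that form is coercive, the projection must equal [X].
   For [nu >= 0] the solution [X] is explicit because [V] has orthonormal
   columns, and its squared norm is the secular function.  Bessel's inequality
   makes the coefficients of the latter nonnegative, so it decreases strictly
   from [norm2 W' ^+ 2] at [0]; since it is [O(1 / nu ^+ 2)], the intermediate
   value theorem gives the multiplier. *)

(** * Euclidean norms, quadratic forms and Bessel's inequality *)

Lemma norm2_sqr (R : realType) n (x : 'cV[R]_n) :
  norm2 x ^+ 2 = \sum_i x i 0 ^+ 2.
Proof. by rewrite sqr_sqrtr // sumr_ge0 // => i _; exact: sqr_ge0. Qed.

Lemma norm2_sqr_eq0 (R : realType) n (x : 'cV[R]_n) : norm2 x ^+ 2 = 0 -> x = 0.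
Proof.
rewrite norm2_sqr => /psumr_eq0P x0; apply/colP => i.
by apply/eqP; rewrite mxE -sqrf_eq0 x0 // => j _; exact: sqr_ge0.
Qed.

Lemma frobenius_normE (R : realType) K d (W : 'M[R]_(K, d)) :
  frobenius_norm W = norm2 (vec W).
Proof.
congr Num.sqrt; rewrite pair_big /= (reindex _ (curry_mxvec_bij K d)) /=.
by apply: eq_bigr => -[i j] _; rewrite mxE mxvecE.
Qed.

Lemma quad_formD (R : realType) n (A : 'M[R]_n) (x y : 'cV[R]_n) : A^T = A ->
  quad_form A (x + y) =
    quad_form A x + (x^T *m A *m y) 0 0 *+ 2 + quad_form A y.
Proof.
move=> sA; have yx : y^T *m A *m x = (x^T *m A *m y)^T.
  by rewrite !trmx_mul trmxK sA mulmxA.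
rewrite /quad_form [(x + y)^T]linearD /= !mulmxDl !mulmxDr yx !mxE; ring.
Qed.

Lemma quad_form1 (R : realType) n (x : 'cV[R]_n) :
  quad_form 1%:M x = norm2 x ^+ 2.
Proof.
rewrite norm2_sqr /quad_form mulmx1 mxE.
by apply: eq_bigr => i _; rewrite mxE expr2.
Qed.

Lemma norm2_sqrD (R : realType) n (x y : 'cV[R]_n) :
  norm2 (x + y) ^+ 2 = norm2 x ^+ 2 + (x^T *m y) 0 0 *+ 2 + norm2 y ^+ 2.
Proof. by rewrite -!quad_form1 quad_formD ?trmx1 // mulmx1. Qed.

Lemma norm2_sqrZ (R : realType) n (c : R) (x : 'cV[R]_n) :
  norm2 (c *: x) ^+ 2 = c ^+ 2 * norm2 x ^+ 2.
Proof.
by rewrite !norm2_sqr mulr_sumr; apply: eq_bigr => i _; rewrite mxE exprMn.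
Qed.

Lemma norm2_orthonormal (R : realType) n p (V : 'M[R]_(n, p)) (b : 'cV[R]_p) :
  orthonormal_cols V -> norm2 (V *m b) ^+ 2 = norm2 b ^+ 2.
Proof.
move=> hV; rewrite -!quad_form1 /quad_form !mulmx1 trmx_mul mulmxA.
by rewrite -(mulmxA b^T) hV mulmx1.
Qed.

(** The residual [w - V *m (V^T *m w)] has nonnegative squared norm, and orthonormality makes that
    squared norm equal to the difference of the two sides. *)
Lemma bessel (R : realType) n p (V : 'M[R]_(n, p)) (w : 'cV[R]_n) :
  orthonormal_cols V -> norm2 (V^T *m w) ^+ 2 <= norm2 w ^+ 2.
Proof.
move=> hV; rewrite -subr_ge0.
have := sqr_ge0 (norm2 (w + V *m ((-1) *: (V^T *m w)))).
rewrite norm2_sqrD norm2_orthonormal // norm2_sqrZ -scalemxAr.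
have -> : (w^T *m (-1 *: (V *m (V^T *m w)))) 0 0 = - norm2 (V^T *m w) ^+ 2.
  rewrite -quad_form1 /quad_form mulmx1 trmx_mul trmxK -scalemxAr scaleN1r.
  by rewrite !mulmxA mxE.
by congr (0 <= _); ring.
Qed.

(** * Coercivity, the Lagrangian and the KKT conditions *)

Lemma quad_form_shift (R : realType) n p (lambda : R) (V : 'M[R]_(n, p))
    (Lam : 'M[R]_p) (x : 'cV[R]_n) :
  quad_form (lambda%:M + V *m Lam *m V^T) x =
    lambda * norm2 x ^+ 2 + quad_form Lam (V^T *m x).
Proof.
rewrite -quad_form1 /quad_form mulmxDr mulmxDl trmx_mul trmxK !mulmxA mulmx1.
by rewrite mul_mx_scalar -scalemxAl !mxE.
Qed.

Lemma weighted_norm_sqr (R : realType) n (Z : 'M[R]_n) x :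
  psdmx Z -> weighted_norm Z x ^+ 2 = quad_form Z x.
Proof. by case=> _ Z0; rewrite sqr_sqrtr. Qed.

(** The Lagrangian is quadratic in [vec U]; expanded around [vec X], its linear term vanishes by the
    stationarity equation, so the expansion is exact. *)
Lemma lagrangian_decomp (R : realType) K d (S : R) (Z : 'M[R]_(K * d))
    (W' X U : 'M[R]_(K, d)) (nu : R) :
    psdmx Z -> Z *m vec X + nu *: vec X = Z *m vec W' ->
  lagrangian S Z W' nu U = lagrangian S Z W' nu X
    + (quad_form Z (vec U - vec X) + nu * norm2 (vec U - vec X) ^+ 2).
Proof.
move=> hZ hX; rewrite /lagrangian /proj_objective !weighted_norm_sqr //.
rewrite !frobenius_normE; set e := vec U - vec X.
have -> : vec U - vec W' = e + (vec X - vec W') by rewrite addrA subrK.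
have -> : norm2 (vec U) = norm2 (e + vec X) by rewrite subrK.
rewrite quad_formD ?norm2_sqrD; last by case: hZ.
have -> : (e^T *m Z *m (vec X - vec W')) 0 0 = - nu * (e^T *m vec X) 0 0.
  rewrite -mulmxA mulmxBr -hX opprD addrA subrr add0r -scaleNr -scalemxAr.
  by rewrite !mxE.
ring.
Qed.

Lemma projection_kkt (R : realType) K d (S lambda : R) (Z : 'M[R]_(K * d))
    (W' X W : 'M[R]_(K, d)) (nu : R) :
    psdmx Z -> 0 < lambda ->
    (forall x, lambda * norm2 x ^+ 2 <= quad_form Z x) ->
    0 <= nu -> 0 <= S -> frobenius_norm X <= S ->
    nu * (frobenius_norm X ^+ 2 - S ^+ 2) = 0 ->
    Z *m vec X + nu *: vec X = Z *m vec W' ->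
    is_projection S Z W' W ->
  W = X /\ is_dual_variable S Z W' W nu.
Proof.
move=> hZ l0 Zl nu0 S0 feasX slackX statX [feasW minW].
have coercive U : lambda * norm2 (vec U - vec X) ^+ 2 <=
    lagrangian S Z W' nu U - lagrangian S Z W' nu X.
  rewrite (lagrangian_decomp S U hZ statX) addrAC subrr add0r.
  by rewrite -[leLHS]addr0 lerD // mulr_ge0 // sqr_ge0.
have WX : W = X.
  (* The projection has the smaller objective, and its penalty term is nonpositive by feasibility,
     while that of [X] is zero by slackness. With [coercive], this forces the distance from [W] to
     [X] to be zero. *)
  have lagW : lagrangian S Z W' nu W <= lagrangian S Z W' nu X.
    apply: lerD; first exact: minW.
    rewrite slackX mulr_ge0_le0 // subr_le0 ler_sqr // nnegrE.
    exact: sqrtr_ge0.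
  suff /norm2_sqr_eq0/eqP : norm2 (vec W - vec X) ^+ 2 = 0.
    by rewrite subr_eq0 => /eqP/trmx_inj/(can_inj mxvecK).
  apply/eqP; rewrite eq_le sqr_ge0 andbT -(pmulr_rle0 _ l0).
  by rewrite (le_trans (coercive W)) // subr_le0.
split=> //; rewrite WX; split=> //; split=> // U _; rewrite -subr_ge0.
by rewrite (le_trans _ (coercive U)) // mulr_ge0 ?sqr_ge0 ?ltW.
Qed.

(** * Diagonal matrices and the scalar ratios of the secular function *)

Lemma psdmx_shift (R : realType) n p (lambda : R) (V : 'M[R]_(n, p))
    (Lam : 'M[R]_p) :
  0 <= lambda -> psdmx Lam -> psdmx (lambda%:M + V *m Lam *m V^T).
Proof.
move=> l0 [sL L0]; split.
  by rewrite linearD /= tr_scalar_mx !trmx_mul trmxK sL mulmxA.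
by move=> x; rewrite quad_form_shift addr_ge0 // mulr_ge0 // sqr_ge0.
Qed.

Lemma psdmx_diag_ge0 (R : realType) p (mu : 'rV[R]_p) i :
  psdmx (diag_mx mu) -> 0 <= mu 0 i.
Proof.
case=> _ /(_ (delta_mx i 0)); rewrite /quad_form trmx_delta -rowE.
by rewrite -colE !mxE eqxx mulr1n.
Qed.

Lemma invmx_diag (R : fieldType) p (e : 'rV[R]_p) : (forall i, e 0 i != 0) ->
  invmx (diag_mx e) = diag_mx (\row_i (e 0 i)^-1).
Proof.
move=> e0; have e1 : diag_mx e *m diag_mx (\row_i (e 0 i)^-1) = 1%:M.
  rewrite mulmx_diag -diag_const_mx; congr diag_mx; apply/rowP => i.
  by rewrite !mxE divff.
by rewrite -[RHS]mul1mx -(mulVmx (mulmx1_unit e1).1) -mulmxA e1 mulmx1.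
Qed.

(** Meant for [c = lambda] and [c = mu 0 i + lambda]: every term of the secular function is a
    multiple of such a squared ratio. *)
Lemma ratio_lt (R : realFieldType) (c x y : R) : 0 < c -> 0 <= x -> x < y ->
  (c / (c + y)) ^+ 2 < (c / (c + x)) ^+ 2.
Proof.
move=> c0 x0 xy; rewrite ltr_pXn2r // ?nnegrE ?divr_ge0 //; try lra.
by rewrite ltr_pM2l // ltf_pV2 ?posrE; lra.
Qed.

Lemma ratio_continuous (R : realType) (A c nu : R) : 0 < c -> 0 <= nu ->
  {for nu, continuous (fun x => A * (c / (c + x)) ^+ 2)}.
Proof.
move=> c0 nu0; suff qc : {for nu, continuous (fun x => c / (c + x))}.
  apply: continuousM; first exact: cst_continuous.
  exact: (continuousM qc qc).
apply: continuousM; first exact: cst_continuous.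
apply: continuousV; first by apply/eqP; lra.
by apply: continuousD; [exact: cst_continuous | exact: id].
Qed.

Definition shrunk (R : realType) n p (lambda : R) (V : 'M[R]_(n, p))
    (Lam : 'M[R]_p) (nu : R) (w : 'cV[R]_n) : 'cV[R]_n :=
  ((lambda / (lambda + nu))%:M + (nu / (lambda + nu)) *:
     (V *m Lam *m invmx ((lambda + nu)%:M + Lam) *m V^T)) *m w.

(** * The explicit stationary point and its secular equation *)

Section DiagonalShift.
Variables (R : realType) (n p : nat) (lambda : R) (V : 'M[R]_(n, p)).
Variables (mu : 'rV[R]_p) (w : 'cV[R]_n).
Hypotheses (lambda_gt0 : 0 < lambda) (mu_ge0 : forall i, 0 <= mu 0 i).
Hypothesis hV : orthonormal_cols V.

Let a := V^T *m w.
Let f := secular lambda V (diag_mx mu) w.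
(** Squared norm of the component of [w] orthogonal to the columns of [V]. *)
Let excess := norm2 w ^+ 2 - norm2 a ^+ 2.

Lemma shift_neq0 nu i : 0 <= nu -> lambda + nu + mu 0 i != 0.
Proof. by move=> nu0; rewrite gt_eqF // ltr_wpDr // ltr_wpDr. Qed.

Lemma invmx_shift nu : 0 <= nu ->
  invmx ((lambda + nu)%:M + diag_mx mu) =
    diag_mx (\row_i (lambda + nu + mu 0 i)^-1).
Proof.
move=> nu0; rewrite -diag_const_mx -linearD /= invmx_diag; last first.
  by move=> i; rewrite !mxE shift_neq0.
by congr diag_mx; apply/rowP => i; rewrite !mxE.
Qed.

(** Correction, in the coordinates of the columns of [V], to the uniform scaling of [w] by
    [lambda / (lambda + nu)]. It brings the factor along column [i] up to [(mu 0 i + lambda) / (mu 0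
    i + lambda + nu)]. *)
Let b nu (z : 'cV[R]_p) : 'cV[R]_p :=
  \col_i (nu / (lambda + nu) * mu 0 i / (lambda + nu + mu 0 i) * z i 0).

Lemma shrunkE nu : 0 <= nu ->
  shrunk lambda V (diag_mx mu) nu w = (lambda / (lambda + nu)) *: w + V *m b nu a.
Proof.
move=> nu0; rewrite /shrunk invmx_shift // mulmxDl mul_scalar_mx; congr (_ + _).
rewrite -(mulmxA V) mulmx_diag -scalemxAl -!mulmxA -/a scalemxAr; congr (_ *m _).
by apply/colP => i; rewrite mul_diag_mx !mxE; ring.
Qed.

Lemma shrunk_stationary nu : 0 <= nu ->
  let Z := lambda%:M + V *m diag_mx mu *m V^T in
  let x := shrunk lambda V (diag_mx mu) nu w in Z *m x + nu *: x = Z *m w.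
Proof.
move=> nu0 Z x.
have nul0 : lambda + nu != 0 by rewrite gt_eqF // ltr_wpDr.
have VtX : V^T *m x = (lambda / (lambda + nu)) *: a + b nu a.
  by rewrite /x shrunkE // mulmxDr mulmxA hV mul1mx -scalemxAr.
rewrite /Z !mulmxDl !mul_scalar_mx -!(mulmxA _ V^T) VtX -/a addrAC -scalerDl.
rewrite /x shrunkE // scalerDr scalerA mulrC divfK // -addrA; congr (_ + _).
(* Once [lambda *: w] is removed, both sides are images under [V], so a scalar identity for each
   coordinate remains. *)
rewrite -!mulmxA scalemxAr -mulmxDr; congr (_ *m _).
move: a => z; apply/colP => i; rewrite !mul_diag_mx !mxE; field.
by rewrite nul0 shift_neq0.
Qed.

Lemma secularE nu : f nu = excess * (lambda / (lambda + nu)) ^+ 2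
  + \sum_i a i 0 ^+ 2 * ((mu 0 i + lambda) / (mu 0 i + lambda + nu)) ^+ 2.
Proof.
congr (_ + _); first by rewrite expr_div_n [RHS]mulrA.
apply: eq_bigr => i _; rewrite expr_div_n [RHS]mulrA tr_col -row_mul -/a.
by rewrite !(mxE, eqxx) mulr1n.
Qed.

(** By Pythagoras: the orthogonal component of [w] is scaled by [lambda / (lambda + nu)], each
    coordinate along [V] by its own ratio. *)
Lemma norm2_shrunk nu : 0 <= nu ->
  norm2 (shrunk lambda V (diag_mx mu) nu w) ^+ 2 = f nu.
Proof.
move=> nu0; rewrite shrunkE // norm2_sqrD norm2_sqrZ norm2_orthonormal //.
rewrite mulmxA linearZ /= -scalemxAl (_ : w^T *m V = a^T); last first.
  by rewrite trmx_mul trmxK.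
rewrite secularE /excess mulrBl (mulrC (norm2 w ^+ 2)) -!addrA; congr (_ + _).
move: a => z; rewrite addrC (norm2_sqr z) (norm2_sqr (b nu z)) mulr_suml.
rewrite -sumrN -scalemxAl !mxE mulr_sumr -!big_split /=.
apply: eq_bigr => i _; rewrite !mxE; field.
by rewrite -addrA addrC shift_neq0 //= gt_eqF ?ltr_wpDr.
Qed.

Lemma excess_ge0 : 0 <= excess.
Proof. by rewrite subr_ge0 bessel. Qed.

Lemma secular0 : f 0 = norm2 w ^+ 2.
Proof.
rewrite secularE addr0 divff ?gt_eqF // expr1n mulr1 norm2_sqr /excess.
rewrite [norm2 a ^+ 2]norm2_sqr -[RHS](subrK (\sum_i a i 0 ^+ 2)) norm2_sqr.
congr (_ + _); apply: eq_bigr => i _; rewrite addr0 divff ?expr1n ?mulr1 //.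
by rewrite gt_eqF // ltr_wpDl.
Qed.

Lemma secular_decreasing x y : w != 0 -> 0 <= x -> x < y -> f y < f x.
Proof.
move=> w0 x0 xy; rewrite lt_neqAle; apply/andP; split; last first.
  rewrite !secularE; apply: lerD.
    by rewrite ler_wpM2l ?excess_ge0 // ltW // ratio_lt.
  apply: ler_sum => i _; rewrite ler_wpM2l ?sqr_ge0 // ltW // ratio_lt //.
  exact: ltr_wpDl.
(* Strictness: every ratio drops strictly, so equal values would force all the nonnegative
   coefficients to vanish, and hence [w] too. *)
apply: contra w0 => /eqP fyx; apply/eqP/norm2_sqr_eq0.
have muxy i := ratio_lt (ltr_wpDl (mu_ge0 i) lambda_gt0) x0 xy.
have lxy := ratio_lt lambda_gt0 x0 xy.
pose drop c := (c / (c + x)) ^+ 2 - (c / (c + y)) ^+ 2.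
have s0 i : true -> 0 <= a i 0 ^+ 2 * drop (mu 0 i + lambda).
  by move=> _; rewrite mulr_ge0 ?sqr_ge0 // subr_ge0 ltW.
have /eqP : excess * drop lambda +
    \sum_i a i 0 ^+ 2 * drop (mu 0 i + lambda) = 0.
  under eq_bigr do rewrite mulrBr; rewrite sumrB mulrBr addrACA -opprD.
  by rewrite -!secularE fyx subrr.
rewrite paddr_eq0 ?sumr_ge0 ?mulr_ge0 ?excess_ge0 ?subr_ge0 ?(ltW lxy) //.
case/andP; rewrite mulf_eq0 [drop _ == 0]subr_eq0 (gt_eqF lxy) orbF subr_eq0.
move=> /eqP -> /eqP/(psumr_eq0P s0) z; rewrite norm2_sqr big1 // => i _.
have /eqP := z i isT.
by rewrite mulf_eq0 [drop _ == 0]subr_eq0 (gt_eqF (muxy i)) orbF => /eqP.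
Qed.

(** Each ratio is at most [C / nu], and the coefficients, nonnegative by Bessel, add up to
    [norm2 w ^+ 2]. *)
Lemma secular_le C nu :
  0 < nu -> lambda <= C -> (forall i, mu 0 i + lambda <= C) ->
  f nu <= norm2 w ^+ 2 * (C / nu) ^+ 2.
Proof.
move=> nu0 lC muC.
have ratio_le c : 0 < c -> c <= C -> (c / (c + nu)) ^+ 2 <= (C / nu) ^+ 2.
  move=> c0 cC; rewrite ler_pXn2r // ?nnegrE ?divr_ge0 //; try lra.
  by apply: ler_pM; rewrite ?invr_ge0 ?lef_pV2 ?posrE; lra.
rewrite secularE -[norm2 w ^+ 2](subrK (norm2 a ^+ 2)) [leRHS]mulrDl.
apply: lerD; first by rewrite ler_wpM2l ?excess_ge0 ?ratio_le.
rewrite norm2_sqr mulr_suml; apply: ler_sum => i _.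
by rewrite ler_wpM2l ?sqr_ge0 ?ratio_le // ltr_wpDl.
Qed.

Lemma secular_continuous nu : 0 <= nu -> {for nu, continuous f}.
Proof.
move=> nu0; rewrite (_ : f = fun x => excess * (lambda / (lambda + x)) ^+ 2 +
  \sum_i a i 0 ^+ 2 * ((mu 0 i + lambda) / (mu 0 i + lambda + x)) ^+ 2).
  apply: continuousD; first exact: ratio_continuous.
  apply: cvg_big => [|i _]; first exact: add_continuous.
  by apply: ratio_continuous => //; rewrite ltr_wpDl.
by apply/boolp.funext => x; rewrite secularE.
Qed.

Lemma secular_root S :
  0 < S -> S < norm2 w -> exists2 nu, 0 < nu & f nu = S ^+ 2.
Proof.
move=> S0 Sw; have w_gt0 : 0 < norm2 w by apply: lt_trans Sw.
pose C := lambda + \sum_i mu 0 i.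
have C0 : 0 < C by rewrite ltr_wpDr // sumr_ge0.
have muC i : mu 0 i + lambda <= C.
  by rewrite addrC lerD2l (bigD1 i) //= lerDl sumr_ge0.
(* Chosen so that the bound of [secular_le] at [B] is exactly [S ^+ 2]. *)
pose B := C * norm2 w / S.
have B0 : 0 < B by rewrite divr_gt0 // mulr_gt0.
have fB : f B <= S ^+ 2.
  apply: le_trans (secular_le B0 _ muC) _; first by rewrite lerDl sumr_ge0.
  suff -> : norm2 w ^+ 2 * (C / B) ^+ 2 = S ^+ 2 by [].
  by rewrite /B; field; rewrite !gt_eqF.
have f0 : S ^+ 2 < f 0 by rewrite secular0 ltr_pXn2r // nnegrE ltW.
have [||nu] := @IVT R f 0 B (S ^+ 2) (ltW B0).
- apply: continuous_in_subspaceT => x; rewrite inE /= in_itv /= => /andP[x0 _].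
  exact: secular_continuous.
- by rewrite ge_min le_max fB (ltW f0) orbT.
rewrite in_itv /= => /andP[nu0 _] fnu; exists nu => //.
(* The intermediate value theorem only gives [0 <= nu]; the root is not [0] because [f 0] exceeds
   [S ^+ 2]. *)
rewrite lt_neqAle nu0 andbT; apply: contraTneq f0 => e.
by rewrite -e in fnu; rewrite fnu ltxx.
Qed.
End DiagonalShift.

Theorem lemma2 (R : realType) (K d m : nat)
    (hK : (0 < K)%N) (hd : (0 < d)%N) (hm : (0 < m)%N)
    (S lambda : R) (hS : 0 < S) (hlambda : 0 < lambda)
    (V : 'M[R]_(K * d, m + K)) (hV : orthonormal_cols V)
    (Lam : 'M[R]_(m + K)) (hLam_diag : is_diag_mx Lam) (hLam_psd : psdmx Lam)
    (Z : 'M[R]_(K * d)) (hZ : Z = lambda%:M + V *m Lam *m V^T)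
    (W' Wnext : 'M[R]_(K, d)) (hproj : is_projection S Z W' Wnext) :
  (norm2 (vec W') <= S -> vec Wnext = vec W')
  /\
  (S < norm2 (vec W') ->
   let f := secular lambda V Lam (vec W') in
   (forall x y : R, 0 < x -> x < y -> f y < f x)
   /\
   exists nu : R,
     [/\ 0 < nu,
         is_dual_variable S Z W' Wnext nu,
         f nu = S ^+ 2,
         forall nu' : R, 0 < nu' -> f nu' = S ^+ 2 -> nu' = nu
       & let M := invmx ((lambda + nu)%:M + Lam) in
         is_diag_mx M
         /\ vec Wnext =
            ((lambda / (lambda + nu))%:M
             + (nu / (lambda + nu)) *: (V *m Lam *m M *m V^T)) *m vec W']).
Proof.
have /diag_mxP[mu def_Lam] := hLam_diag; subst Lam.
have mu_ge0 i : 0 <= mu 0 i by exact: psdmx_diag_ge0.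
have hZpsd : psdmx Z by rewrite hZ; apply: psdmx_shift => //; exact: ltW.
have Zlambda x : lambda * norm2 x ^+ 2 <= quad_form Z x.
  by rewrite hZ quad_form_shift lerDl; case: hLam_psd.
split=> [w_le | w_gt f].
  (* Inactive constraint: with multiplier [0], the point [W'] itself is feasible and stationary. *)
  have [|||||-> _ //] :=
    projection_kkt (X := W') (nu := 0) hZpsd hlambda Zlambda _ _ _ _ _ hproj.
  - by [].
  - exact: ltW.
  - by rewrite frobenius_normE.
  - by rewrite mul0r.
  - by rewrite scale0r addr0.
have w0 : vec W' != 0.
  apply: contraTneq w_gt => ->; rewrite -leNgt /norm2 big1 ?sqrtr0 ?ltW // => i _.
  by rewrite mxE expr0n.
have f_decr x y : 0 <= x -> x < y -> f y < f x by exact: secular_decreasing.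
split=> [x y /ltW|]; first exact: f_decr.
have [nu nu_gt0 fnu] := secular_root hlambda mu_ge0 hV hS w_gt.
have nu_ge0 := ltW nu_gt0.
(* The closed form reshaped into a matrix; its norm is [S] because [nu] solves the secular equation,
   which yields both feasibility and slackness. *)
pose X : 'M[R]_(K, d) := vec_mx (shrunk lambda V (diag_mx mu) nu (vec W'))^T.
have vecX : vec X = shrunk lambda V (diag_mx mu) nu (vec W').
  by rewrite /vec vec_mxK trmxK.
have normX : frobenius_norm X ^+ 2 = S ^+ 2.
  by rewrite frobenius_normE vecX norm2_shrunk.
have [||||WX dual] :=
  projection_kkt (X := X) hZpsd hlambda Zlambda nu_ge0 _ _ _ _ hproj.
- exact: ltW.
- by rewrite -ler_sqr ?normX ?nnegrE ?(ltW hS) //; exact: sqrtr_ge0.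
- by rewrite normX subrr mulr0.
- by rewrite vecX hZ; exact: shrunk_stationary.
exists nu; split=> // [nu' nu'_gt0 fnu'|M].
  case: (ltgtP nu' nu) => // lt_nu; have := f_decr _ _ _ lt_nu.
    by rewrite fnu' [f nu]fnu ltxx => /(_ (ltW nu'_gt0)).
  by rewrite fnu' [f nu]fnu ltxx => /(_ nu_ge0).
split; last by rewrite WX vecX.
by rewrite /M invmx_shift // diag_mx_is_diag.
Qed.
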